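(* If the variables $x_1,\ldots,x_n$ commute, then $$S_k^*(x_1,\ldots,x_n)=h_k^*(x_1,\ldots,x_n)\ \ (k\ge1),\qquad \Lambda_k^*(x_1,\ldots,x_n)=e_k^*(x_1,\ldots,x_n)\ \ (1\le k\le n),$$ where $h_k^*$ and $e_k^*$ are the (commutative) complete homogeneous and elementary shifted symmetric functions of Okounkov and Olshanski.
   Context: $\Bbbk$ is a field of characteristic zero; in the claim the $x_1,\ldots,x_n$ are commuting indeterminates and the identities hold in the field $\Bbbk(x_1,\ldots,x_n)$. The falling powers are $y^{\downarrow m}=y(y-1)\cdots(y-m+1)$, $y^{\downarrow0}=1$. Quasideterminants: for an $n\times n$ matrix $A$ such that the matrix $A^{pq}$ (delete row $p$ and column $q$) is invertible, $|A|_{pq}=a_{pq}-r(A^{pq})^{-1}c$, where $r$ is the $p$-th row of $A$ with $a_{pq}$ removed and $c$ is the $q$-th column of $A$ with $a_{pq}$ removed. For a set $E=\{m_1<\cdots<m_n\}$ of nonnegative integers and $e=m_r\in E$ let $V(E;e)=|A|_{rn}$ where $A$ is the $n\times n$ matrix with entries $A_{pq}=(x_q+n-q)^{\downarrow m_p}$. The (specialized) shifted symmetric functions, corresponding to the parameter sequence $a_i=i-1$, are $$S_k^*(x_1,\ldots,x_n)=V(\{0,\ldots,n-2,n+k-1\};n+k-1)\cdot V(\{0,\ldots,n-1\};n-1)^{-1},$$ $$\Lambda_k^*(x_1,\ldots,x_n)=(-1)^{k-1}V(\{0,\ldots,n\}\setminus\{n-k\};n)\cdot V(\{0,\ldots,n-1\};n-k)^{-1}.$$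 The shifted Schur polynomial of a partition $\lambda=(\lambda_1\ge\cdots\ge\lambda_n\ge0)$ is $$s_\lambda^*(x_1,\ldots,x_n)=\frac{\det\bigl((x_q+n-q)^{\downarrow(\lambda_p+n-p)}\bigr)_{1\le p,q\le n}}{\det\bigl((x_q+n-q)^{\downarrow(n-p)}\bigr)_{1\le p,q\le n}},$$ and $h_k^*=s_{(k)}^*$, $e_k^*=s_{(1^k)}^*$. *)

(* Defs.v *)
From HB Require Import structures.
From mathcomp Require Import all_boot all_order all_algebra.
From mathcomp Require Import fraction finmap mpoly.

Set Implicit Arguments.
Unset Strict Implicit.
Unset Printing Implicit Defensive.

Import GRing.Theory.
Local Open Scope ring_scope.
Local Open Scope fset_scope.

(* The number of variables is n = m.+1; indices are 0-based, so the           *)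
(* mathematical n - q (1-based q) is m - q, and the n-th column is ord_max.   *)

Definition falling (R : pzRingType) (y : R) (k : nat) : R :=
  \prod_(i < k) (y - i%:R).

(* invmx is total: the value of [quasidet A p q] is meaningful only under     *)
(* [quasidet_defined A p q].                                                  *)
Definition quasidet_defined (R : comUnitRingType) (n : nat) (A : 'M[R]_n)
    (p q : 'I_n) : bool :=
  row' p (col' q A) \in unitmx.

Definition quasidet (R : comUnitRingType) (n : nat) (A : 'M[R]_n)
    (p q : 'I_n) : R :=
  A p q - (col' q (row p A) *m invmx (row' p (col' q A))
             *m row' p (col q A)) ord0 ord0.

(* [sort leq E] lists E = {m_1 < ... < m_n} in increasing order. These        *)
(* definitions are meant for #|` E| = m.+1 and e \in E.                       *)
Definition Vmx (F : fieldType) (m : nat) (x : 'I_m.+1 -> F) (E : {fset nat}) :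
    'M[F]_m.+1 :=
  \matrix_(p, q) falling (x q + (m - q)%:R) (nth 0%N (sort leq E) p).

Definition Vrow (m : nat) (E : {fset nat}) (e : nat) : 'I_m.+1 :=
  inord (index e (sort leq E)).

Definition V_defined (F : fieldType) (m : nat) (x : 'I_m.+1 -> F)
    (E : {fset nat}) (e : nat) : bool :=
  quasidet_defined (Vmx x E) (Vrow m E e) ord_max.

Definition V (F : fieldType) (m : nat) (x : 'I_m.+1 -> F)
    (E : {fset nat}) (e : nat) : F :=
  quasidet (Vmx x E) (Vrow m E e) ord_max.

Definition below (n : nat) : {fset nat} := [fset i in iota 0 n].

Definition Sset (n k : nat) : {fset nat} := (n + k - 1)%N |` below (n - 1).

Definition Sstar (F : fieldType) (m k : nat) (x : 'I_m.+1 -> F) : F :=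
  let n := m.+1 in
  V x (Sset n k) (n + k - 1) * (V x (below n) (n - 1))^-1.

Definition Sstar_defined (F : fieldType) (m k : nat) (x : 'I_m.+1 -> F) :
    bool :=
  let n := m.+1 in
  [&& V_defined x (Sset n k) (n + k - 1), V_defined x (below n) (n - 1)
    & V x (below n) (n - 1) != 0].

Definition Lambdaset (n k : nat) : {fset nat} := below n.+1 `\ (n - k)%N.

Definition Lambdastar (F : fieldType) (m k : nat) (x : 'I_m.+1 -> F) : F :=
  let n := m.+1 in
  (-1) ^+ (k - 1) * V x (Lambdaset n k) n * (V x (below n) (n - k))^-1.

Definition Lambdastar_defined (F : fieldType) (m k : nat) (x : 'I_m.+1 -> F) :
    bool :=
  let n := m.+1 in
  [&& V_defined x (Lambdaset n k) n, V_defined x (below n) (n - k)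
    & V x (below n) (n - k) != 0].

(* A partition is a nonincreasing list of at most m.+1 parts, padded by zeros.*)
Definition sschur_num (F : fieldType) (m : nat) (lam : seq nat)
    (x : 'I_m.+1 -> F) : F :=
  \det (\matrix_(p < m.+1, q < m.+1)
          falling (x q + (m - q)%:R) (nth 0%N lam p + (m - p))).

Definition sschur_den (F : fieldType) (m : nat) (x : 'I_m.+1 -> F) : F :=
  \det (\matrix_(p < m.+1, q < m.+1) falling (x q + (m - q)%:R) (m - p)).

Definition sschur (F : fieldType) (m : nat) (lam : seq nat)
    (x : 'I_m.+1 -> F) : F :=
  sschur_num lam x / sschur_den x.

Definition hstar (F : fieldType) (m k : nat) (x : 'I_m.+1 -> F) : F :=
  sschur [:: k] x.

Definition estar (F : fieldType) (m k : nat) (x : 'I_m.+1 -> F) : F :=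
  sschur (nseq k 1%N) x.

Definition indet (K : fieldType) (n : nat) (i : 'I_n) :
    {fraction {mpoly K[n]}} :=
  tofrac ('X_i : {mpoly K[n]}).

(* Main.v *)
Require Import Defs.
From HB Require Import structures.
From mathcomp Require Import all_boot all_order all_algebra.
From mathcomp Require Import perm fraction finmap mpoly zify ring.

Set Implicit Arguments.
Unset Strict Implicit.
Unset Printing Implicit Defensive.

Import GRing.Theory.
Local Open Scope ring_scope.

(** A quasideterminant over a commutative ring is a ratio of ordinary ones:
    [quasidet A p q * cofactor A p q = \det A] ([quasidet_cofactor]).  In each
    of the quotients defining [Sstar] and [Lambdastar], the two matrices become
    equal once the distinguished row and the last column are deleted, since the
    same exponents remain.  The minors therefore cancel and the quotient is, up
    to the sign contributed by the positions of the two deleted rows, the ratio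
    of the two full determinants ([quasidet_ratio]).  For [Sstar] both deleted
    rows are last and there is no sign; for [Lambdastar] the rows are the
    [n]-th and the [(n - k + 1)]-st, and their sign is the prefactor
    [(-1) ^+ (k - 1)].  The shifted Schur polynomial is the same ratio of
    determinants with the rows listed in decreasing order of exponents in both
    the numerator and the denominator ([sschurE]).

    All the divisions are legitimate because a determinant of falling powers
    with strictly increasing exponents is nonzero ([falling_det_neq0]).  Giving
    the [q]-th argument of the falling powers the value of the [q]-th exponent
    makes the matrix triangular, for [j (j - 1) ... (j - i + 1)] vanishes when
    [j < i], and its diagonal consists of factorials, which are nonzero in
    characteristic zero. *)

(** * Quasideterminants over commutative rings *)

(** Let [z] have entry [1] at [q] and the entries of
    [- invmx (row' p (col' q A)) *m row' p (col q A)] elsewhere.  By the choice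
    of [z], the product [A *m z] is [quasidet A p q] at [p] and zero in all the
    other rows.  Multiplying by the adjugate and reading the entry at [q] gives
    the formula. *)
Lemma quasidet_cofactor (R : comUnitRingType) n (A : 'M[R]_n.+1) p q :
  quasidet_defined A p q -> quasidet A p q * cofactor A p q = \det A.
Proof.
rewrite /quasidet_defined => uM.
set y := invmx (row' p (col' q A)) *m row' p (col q A).
pose z : 'cV[R]_n.+1 := \col_j if unlift q j is Some i then - y i 0 else 1.
have zq : z q 0 = 1 by rewrite mxE unlift_none.
have zl i : z (lift q i) 0 = - y i 0 by rewrite mxE liftK.
have Az i : (A *m z) i 0 = A i q - \sum_j A i (lift q j) * y j 0.
  rewrite mxE (bigD1_ord q) //= zq mulr1; congr (_ + _).
  by rewrite -sumrN; apply: eq_bigr => j _; rewrite zl mulrN.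
have Azp : (A *m z) p 0 = quasidet A p q.
  rewrite Az /quasidet -mulmxA -/y; congr (_ - _).
  by rewrite mxE; apply: eq_bigr => j _; rewrite !mxE.
have Azl i : (A *m z) (lift p i) 0 = 0.
  rewrite Az.
  have := mulKVmx uM (row' p (col q A)); rewrite -/y => /matrixP/(_ i 0).
  rewrite !mxE => <-; apply/eqP; rewrite subr_eq0; apply/eqP.
  by apply: eq_bigr => j _; rewrite !mxE.
have /(congr1 (fun B => (B *m z) q 0)) /= := mul_adj_mx A.
rewrite -mulmxA mul_scalar_mx [RHS]mxE zq mulr1 => <-.
rewrite mxE (bigD1_ord p) //= big1 ?addr0; last by move=> i _; rewrite Azl mulr0.
by rewrite Azp mulrC mxE.
Qed.

(** When the two matrices share the complementary minor, it cancels between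
    [\det A = quasidet A p q * cofactor A p q] and the same formula for [B]. *)
Lemma quasidet_ratio (F : fieldType) n (A B : 'M[F]_n.+1) p p' q :
    row' p (col' q A) = row' p' (col' q B) ->
    quasidet_defined A p q -> \det B != 0 ->
  [/\ quasidet_defined B p' q, quasidet B p' q != 0 &
      quasidet A p q / quasidet B p' q
        = (-1) ^+ (p + p') * (\det A / \det B)].
Proof.
move=> eqM dA; have dB : quasidet_defined B p' q.
  by move: dA; rewrite /quasidet_defined eqM.
rewrite -(quasidet_cofactor dA) -(quasidet_cofactor dB) mulf_eq0 negb_or.
case/andP=> B0 cB0; split=> //; rewrite /cofactor eqM.
move: cB0; rewrite /cofactor; set D := \det _ => cB0.
have D0 : D != 0 by move: cB0; rewrite mulf_eq0 negb_or => /andP[].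
have eps (i : nat) : (-1) ^+ i * (-1) ^+ i = 1 :> F.
  by rewrite -exprMn mulrNN mulr1 expr1n.
rewrite !exprD !invfM !invr_sign.
move: (eps p) (eps p') (eps q) (divff D0).
set sp := (-1) ^+ p; set sp' := (-1) ^+ p'; set sq := (-1) ^+ q => ep ep' eq eD.
set a := quasidet A p q; set b := quasidet B p' q.
transitivity ((sp * sp) * (sp' * sp') * (sq * sq) * (D / D) * (a / b)).
  by rewrite ep ep' eq eD !mul1r.
ring.
Qed.

(** * Determinants of falling powers *)

Lemma rmorph_falling (R S : pzRingType) (f : {rmorphism R -> S}) y k :
  f (falling y k) = falling (f y) k.
Proof.
by rewrite /falling rmorph_prod; apply: eq_bigr => i _; rewrite rmorphB rmorph_nat.
Qed.

Lemma falling_nat_small (R : comPzRingType) i j :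
  (i < j)%N -> falling (i%:R : R) j = 0.
Proof. by move=> ltij; rewrite /falling (bigD1 (Ordinal ltij)) //= subrr mul0r. Qed.

Lemma falling_nat_diag (R : comPzRingType) i : falling (i%:R : R) i = (i`!)%:R.
Proof.
rewrite -ffactnn ffact_prod natr_prod; apply: eq_bigr => j _.
by rewrite natrB // ltnW.
Qed.

Section FallingDet.
Variables (K : fieldType) (charK : [pchar K] =i pred0) (n : nat).

(** The polynomial determinant is nonzero because it has a nonzero value: the
    point is chosen so that the [j]-th argument takes the value [e j].  The
    injection [f] selects the variables in use, so that minors omitting some
    columns are covered. *)
Lemma falling_det_neq0 s (f : 'I_s -> 'I_n) (c : 'I_s -> nat)
    (e : 'I_s -> nat) :
    injective f -> (forall i j : 'I_s, (i < j)%N -> (e i < e j)%N) ->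
  \det (\matrix_(i, j) falling (@indet K n (f j) + (c j)%:R) (e i)) != 0.
Proof.
move=> injf inc_e.
pose M : 'M[{mpoly K[n]}]_s :=
  \matrix_(i, j) falling ('X_(f j) + (c j)%:R) (e i).
have -> : \matrix_(i, j) falling (@indet K n (f j) + (c j)%:R) (e i)
          = map_mx (@tofrac _) M.
  by apply/matrixP=> i j; rewrite !mxE rmorph_falling rmorphD rmorph_nat.
rewrite det_map_mx tofrac_eq0.
pose v (i : 'I_n) : K :=
  if [pick j | f j == i] is Some j then (e j)%:R - (c j)%:R else 0.
have vf j : v (f j) = (e j)%:R - (c j)%:R.
  rewrite /v; case: pickP => [j' /eqP/injf->//|/(_ j)].
  by rewrite eqxx.
suff: meval v (\det M) != 0 by apply: contraNneq => ->; rewrite rmorph0.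
have Mv i j : (map_mx (meval v) M) i j = falling (e j)%:R (e i).
  by rewrite !mxE rmorph_falling rmorphD /= rmorph_nat mevalXU vf subrK.
rewrite -det_map_mx -det_tr det_trig; last first.
  apply/is_trig_mxP => i j ltij.
  by rewrite mxE Mv falling_nat_small ?inc_e.
apply/prodf_neq0 => i _; rewrite mxE Mv falling_nat_diag.
by rewrite (pcharf0P K).1 // -lt0n fact_gt0.
Qed.

End FallingDet.

(** * Matrices of falling powers with increasing exponents *)

(** A function on all of [nat], rather than on ['I_m.+1], lets the enumeration of
    the exponents be computed without carrying bounds. *)
Definition fallmx (F : fieldType) m (x : 'I_m.+1 -> F) (f : nat -> nat) :
    'M[F]_m.+1 :=
  \matrix_(p, q) falling (x q + (m - q)%:R) (f p).

Section Exponents.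
Variables (m : nat) (f : nat -> nat).
Hypothesis inc_f : {homo f : i j / (i < j)%N}.

Lemma sort_fset_mkseq (E : {fset nat}) n :
  E =i mkseq f n -> sort leq E = mkseq f n.
Proof.
move=> defE; have sorted_f : sorted ltn (mkseq f n).
  by apply: homo_sorted (iota_ltn_sorted 0 n).
have /andP[uniq_f leq_f] : uniq (mkseq f n) && sorted leq (mkseq f n).
  by rewrite -ltn_sorted_uniq_leq.
apply: (sorted_eq leq_trans anti_leq) => //.
  exact: sort_sorted leq_total _.
by rewrite perm_sort; apply: uniq_perm => //; apply: fset_uniq.
Qed.

Variable E : {fset nat}.
Hypothesis defE : E =i mkseq f m.+1.

Lemma VmxE (F : fieldType) (x : 'I_m.+1 -> F) : Vmx x E = fallmx x f.
Proof.
by apply/matrixP=> p q; rewrite !mxE (sort_fset_mkseq defE) nth_mkseq.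
Qed.

Lemma VrowE (p : 'I_m.+1) : Vrow m E (f p) = p.
Proof.
have inj_f : injective f.
  by move=> i j eqf; case: (ltngtP i j) => // /inc_f; rewrite eqf ltnn.
rewrite /Vrow (sort_fset_mkseq defE) /mkseq index_map //.
have {1}-> : (p : nat) = nth 0%N (iota 0 m.+1) p by rewrite nth_iota.
by rewrite index_uniq ?size_iota ?iota_uniq ?inord_val.
Qed.

End Exponents.

Section Ratio.
Variables (K : fieldType) (charK : [pchar K] =i pred0) (m : nat).
Let x := @indet K m.+1.

Lemma fallmx_det_neq0 f : {homo f : i j / (i < j)%N} -> \det (fallmx x f) != 0.
Proof. by move=> inc_f; apply: falling_det_neq0 => // i j; apply: inc_f. Qed.

Lemma fallmx_quasidet_defined f p : {homo f : i j / (i < j)%N} ->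
  quasidet_defined (fallmx x f) p ord_max.
Proof.
move=> inc_f; rewrite /quasidet_defined unitmxE unitfE.
rewrite (_ : row' _ _ = \matrix_(i, j)
  falling (x (lift ord_max j) + (m - lift ord_max j)%:R) (f (lift p i))).
  apply: falling_det_neq0 => //; first exact: lift_inj.
  by move=> i j ltij; apply: inc_f; rewrite ltnNge leq_bump2 -ltnNge.
by apply/matrixP=> i j; rewrite !mxE.
Qed.

(** The Schur quotient lists the exponents in decreasing order; reversing the
    rows changes numerator and denominator by the same sign. *)
Lemma sschurE lam f :
    (forall i, (i <= m)%N -> nth 0%N lam (m - i) + i = f i)%N ->
    [/\ sschur_den x != 0
      & sschur lam x = \det (fallmx x f) / \det (fallmx x id)].
Proof.
move=> lam_f; pose r : 'S_m.+1 := perm (@rev_ord_inj m.+1).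
have rev_det g h : (forall i, (i <= m)%N -> h (m - i)%N = g i) ->
    \det (\matrix_(p < m.+1, q < m.+1) falling (x q + (m - q)%:R) (h p))
    = (-1) ^+ r * \det (fallmx x g).
  move=> gh; rewrite -det_perm -det_mulmx -row_permE; congr (\det _).
  apply/matrixP=> p q; rewrite !mxE permE /= subSS -gh ?leq_subr //.
  by rewrite subKn // -ltnS.
rewrite /sschur /sschur_num.
have -> : sschur_den x = (-1) ^+ r * \det (fallmx x id).
  by apply: rev_det (fun p => m - p)%N _ => i lei; rewrite subKn.
rewrite (rev_det f (fun p => nth 0%N lam p + (m - p))%N); last first.
  by move=> i lei; rewrite subKn // lam_f.
have sgn0 : (-1) ^+ r != 0 :> {fraction {mpoly K[m.+1]}} by rewrite signr_eq0.
by rewrite mulf_neq0 ?fallmx_det_neq0 // invfM mulrACA divff ?mul1r.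
Qed.

(** The hypothesis on [lift] says that [E] without its [p]-th element is [E']
    without its [p']-th one, which is what makes the two minors equal. *)
Lemma V_ratio (E E' : {fset nat}) f g (p p' : 'I_m.+1) e e' :
    {homo f : i j / (i < j)%N} -> {homo g : i j / (i < j)%N} ->
    E =i mkseq f m.+1 -> E' =i mkseq g m.+1 -> f p = e -> g p' = e' ->
    (forall i : 'I_m, f (lift p i) = g (lift p' i)) ->
  [&& V_defined x E e, V_defined x E' e' & V x E' e' != 0]
  /\ V x E e / V x E' e'
    = (-1) ^+ (p + p') * (\det (fallmx x f) / \det (fallmx x g)).
Proof.
move=> inc_f inc_g defE defE' <- <- eq_fg.
rewrite /V_defined /V (VrowE inc_f defE) (VrowE inc_g defE').
rewrite (VmxE inc_f defE) (VmxE inc_g defE').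
have eqM : row' p (col' ord_max (fallmx x f))
           = row' p' (col' ord_max (fallmx x g)).
  by apply/matrixP=> i j; rewrite !mxE eq_fg.
have d := fallmx_quasidet_defined p inc_f.
have [d' n0 ->] := quasidet_ratio eqM d (fallmx_det_neq0 inc_g).
by rewrite d d' n0.
Qed.

End Ratio.

(** * The two families of exponents *)

(** The increasing enumeration of the exponents [0, ..., h - 1, h + k, h + k + 1]
    and so on: a jump of [k] before the last of the exponents for [Sstar], a
    jump of [1] over the omitted exponent for [Lambdastar]. *)
Definition gap h k i : nat := (h <= i) * k + i.

Lemma gap_inc h k : {homo gap h k : i j / (i < j)%N}.
Proof.
move=> i j ltij; rewrite /gap -addnS leq_add // leq_mul2r.
by apply/orP; right; case: (leqP h i) => // lehi; rewrite (leq_trans lehi) // ltnW.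
Qed.

Lemma gap_lt h k i : (i < h)%N -> gap h k i = i.
Proof. by rewrite /gap ltnNge => /negPf->. Qed.

Lemma gap_ge h k i : (h <= i)%N -> gap h k i = (k + i)%N.
Proof. by rewrite /gap => ->; rewrite mul1n. Qed.

Lemma belowE n : below n =i mkseq id n.
Proof. by move=> i; rewrite /below inE /mkseq map_id. Qed.

Lemma SsetE m k : Sset m.+1 k =i mkseq (gap m k) m.+1.
Proof.
move=> i; have -> : (i \in Sset m.+1 k) = (i == m + k)%N || (i < m)%N.
  by rewrite !inE mem_iota add0n subn1 addSn subn1.
apply/idP/mapP => [|[j]].
  case/orP=> [/eqP->|lti]; [exists m | exists i].
  - by rewrite mem_iota /=; lia.
  - by rewrite gap_ge //; lia.
  - by rewrite mem_iota /=; lia.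
  - by rewrite gap_lt //; lia.
rewrite mem_iota /= => ltj ->.
have [ltjm|lemj] := ltnP j m; first by rewrite gap_lt //; lia.
by rewrite gap_ge //; lia.
Qed.

Lemma LambdasetE m k : (1 <= k <= m.+1)%N ->
  Lambdaset m.+1 k =i mkseq (gap (m.+1 - k) 1) m.+1.
Proof.
move=> /andP[k1 kn] i.
have -> : (i \in Lambdaset m.+1 k) = (i != m.+1 - k)%N && (i < m.+2)%N.
  by rewrite in_fsetD1 belowE /mkseq map_id mem_iota.
apply/idP/mapP => [/andP[ni lti]|[j]].
  have [ltih|lehi] := ltnP i (m.+1 - k).
    by exists i; rewrite ?mem_iota ?gap_lt //=; lia.
  by exists i.-1; rewrite ?mem_iota ?gap_ge //=; lia.
rewrite mem_iota /= => ltj ->.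
have [ltjh|lehj] := ltnP j (m.+1 - k); first by rewrite gap_lt //; lia.
by rewrite gap_ge //; lia.
Qed.

Lemma id_inc : {homo id : i j / (i < j)%N}. Proof. by []. Qed.

Theorem proposition56 (K : fieldType) (charK : [pchar K] =i pred0) (m : nat) :
  let n := m.+1 in
  let x : 'I_n -> {fraction {mpoly K[n]}} := @indet K n in
  (forall k : nat, (1 <= k)%N ->
     [/\ Sstar_defined k x, sschur_den x != 0 & Sstar k x = hstar k x]) /\
  (forall k : nat, (1 <= k <= n)%N ->
     [/\ Lambdastar_defined k x, sschur_den x != 0
       & Lambdastar k x = estar k x]).
Proof.
split=> k => [k1|/[dup] k_range /andP[k1 kn]].
  have [|den0 hE] := @sschurE K charK m [:: k] (gap m k).
    move=> i lei; have [ltim|lemi] := ltnP i m.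
      by rewrite gap_lt // -[(m - i)%N]prednK ?subn_gt0 //= nth_nil.
    by have ->: i = m by [lia]; rewrite gap_ge // subnn.
  have eq_del (i : 'I_m) : gap m k (lift ord_max i) = id (lift ord_max i : nat).
    by rewrite lift_max gap_lt.
  have eS : gap m k (ord_max : 'I_m.+1) = (m.+1 + k - 1)%N by rewrite gap_ge //=; lia.
  have e0 : id ((ord_max : 'I_m.+1) : nat) = (m.+1 - 1)%N by rewrite subn1.
  have [defS eqS] :=
    V_ratio charK (@gap_inc m k) id_inc (SsetE m k) (belowE _) eS e0 eq_del.
  split; [exact: defS | exact: den0 |].
  by rewrite /Sstar eqS /hstar hE exprD -expr2 sqrr_sign mul1r.
set h := (m.+1 - k)%N.
have lthm : (h < m.+1)%N by lia.
have [|den0 hE] := @sschurE K charK m (nseq k 1%N) (gap h 1).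
  move=> i lei; rewrite nth_nseq; have [ltih|lehi] := ltnP i h.
    by rewrite gap_lt // ifN //; lia.
  by rewrite gap_ge // ifT //; lia.
have eq_del (i : 'I_m) :
    gap h 1 (lift ord_max i) = id (lift (Ordinal lthm) i : nat).
  (* Jumping over [h] is exactly [bump h], the map underlying [lift]. *)
  by rewrite lift_max /= /gap muln1.
have eL : gap h 1 (ord_max : 'I_m.+1) = m.+1 by rewrite gap_ge //=; lia.
have e0 : id (Ordinal lthm : nat) = h by [].
have [defL eqL] :=
  V_ratio charK (@gap_inc h 1) id_inc (LambdasetE k_range) (belowE _) eL e0 eq_del.
split; [exact: defL | exact: den0 |].
(* The total sign exponent is [(k - 1) + m + (m + 1 - k) = 2 * m]. *)
rewrite /Lambdastar -mulrA eqL /estar hE mulrA -exprD.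
have /negPf even_sum : ~~ odd (k - 1 + (m + h)) by lia.
by rewrite -signr_odd even_sum expr0 mul1r.
Qed.
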